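(* Let $p$ be a zone tariff with overlap areas (ZOA) with an increasing price function $P:\mathbb{N}_{\ge 1}\to\mathbb{R}_{\ge 0}$. Consider the algorithm that, for two stations $x,y\in V$, computes a shortest $x$-$y$-path $W'$ in the overlaps-resolved graph $G'=(V',E')$ with edge weights $b'$, and let $W$ be the $x$-$y$-path in the PTN obtained from $W'$ by replacing each node $(v,Z)$ by $v$ and deleting consecutive repetitions. (i) The algorithm computes a cheapest path $W$ from $x$ to $y$ and hence a cheapest standard ticket in polynomial time. (ii) If $P$ is subadditive, i.e. $P(k_1+k_2)\le P(k_1)+P(k_2)$ for all $k_1,k_2\in\mathbb{N}_{\ge 1}$, then the algorithm yields a cheapest ticket from $x$ to $y$, namely $(W)$, in polynomial time.
   Context: ''Increasing'' means non-decreasing. A PTN is a finite, simple, connected, undirected graph $(V,E)$. A path is a finite sequence $(x_1,\dots,x_n)$, $n\ge 1$, of (not necessarily distinct) nodes with consecutive nodes adjacent; $\mathcal{W}$ is the set of all paths. A zone cover $\mathcal{Z}$ is a family of nonempty subsets of $V$ (zones) whose union is $V$; $\mathrm{zones}(v)\subseteq\mathcal{Z}$ is the (nonempty) set of zones containing $v$. For a path $W=(x_1,\dots,x_n)$, an assignment is a map $h:\{1,\dots,n\}\to\mathcal{Z}$ with $h(i)\in\mathrm{zones}(x_i)$; put $b^h(x_i,x_{i+1})=0$ if $h(i)=h(i+1)$ and $1$ otherwise, and $z(W)=1+\min_h\sum_{i=1}^{n-1}b^h(x_i,x_{i+1})$. A fare structure $p:\mathcal{W}\to\mathbb{R}_{\ge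 0}$ is a ZOA with respect to an increasing $P$ if $p(W)=P(z(W))$ for all $W\in\mathcal{W}$. The overlaps-resolved graph $G'=(V',E')$ has $V'=V\cup V_{\mathcal{Z}}$ with $V_{\mathcal{Z}}=\{(x,Z)\in V\times\mathcal{Z}: Z\in\mathrm{zones}(x)\}$ and $E'=E_1'\cup E_2'$ with $E_1'=\{\{x,(x,Z)\}: x\in V,(x,Z)\in V_{\mathcal{Z}}\}$ and $E_2'=\{\{(x,Z_1),(y,Z_2)\}: (x,Z_1),(y,Z_2)\in V_{\mathcal{Z}},\{x,y\}\in E\}$. Edge weights: $b'(e)=1$ for $e\in E_1'$; for $e=\{(x,Z_1),(y,Z_2)\}\in E_2'$, $b'(e)=0$ if $Z_1=Z_2$ and $b'(e)=1$ if $Z_1\ne Z_2$. A ticket of $W\in\mathcal{W}$ is a finite sequence of paths $T=(H_1,\dots,H_t)$ such that $W$ is a concatenation $W_1+\dots+W_t$ of subpaths with $W_j$ a subpath of $H_j$ for each $j$; its price is $\sum_{j=1}^t p(H_j)$. The standard ticket of $W$ is $(W)$. A cheapest ticket (resp. cheapest standard ticket) from $x$ to $y$ is one of minimum price among all tickets (resp. standard tickets) of all $x$-$y$-paths; a cheapest path from $x$ to $y$ is an $x$-$y$-path $W$ minimizing $p(W)$. *)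

(* Defs.v *)
From mathcomp Require Import all_boot all_order all_algebra reals.

Set Implicit Arguments.
Unset Strict Implicit.
Unset Printing Implicit Defensive.

Import Order.TTheory GRing.Theory Num.Theory.

Definition is_walk (T : eqType) (e : rel T) (W : seq T) : bool :=
  if W is u :: s then path e u s else false.

Definition walk_between (T : eqType) (e : rel T) (x y : T) (W : seq T) : bool :=
  if W is u :: s then [&& u == x, path e u s & last u s == y] else false.

Definition walk_weight (T : Type) (b : T -> T -> nat) (W : seq T) : nat :=
  if W is u :: s then sumn (pairmap b u s) else 0.

Definition shortest_walk (T : eqType) (e : rel T) (b : T -> T -> nat)
    (x y : T) (W : seq T) : Prop :=
  walk_between e x y W /\
  forall W', walk_between e x y W' -> walk_weight b W <= walk_weight b W'.

Record ptn := Ptn {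
  station :> finType;
  adj : rel station;
  adj_sym : symmetric adj;
  adj_irr : irreflexive adj;
  adj_connected : forall x y, connect adj x y
}.

Definition zone_cover (N : ptn) (Z : {set {set N}}) : Prop :=
  set0 \notin Z /\ cover Z = [set: N].

Definition zones (N : ptn) (Z : {set {set N}}) (v : N) : {set {set N}} :=
  [set A in Z | v \in A].

Definition zone_change (N : ptn) (A B : {set N}) : nat := A != B.

(* An assignment for [W] is a tuple [h] of zones of the same length. All sums
   are at most [(size W).-1], so this neutral element does not affect the
   minimum. *)
Definition zone_count (N : ptn) (Z : {set {set N}}) (W : seq N) : nat :=
  1 + \big[minn/(size W).-1]_(h : (size W).-tuple {set N}
                             | all2 (fun v A => A \in zones Z v) W h)
        walk_weight (@zone_change N) h.

Definition zoned_station (N : ptn) (Z : {set {set N}}) : finType :=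
  {c : N * {set N} | c.2 \in zones Z c.1}.

Definition resolved_node (N : ptn) (Z : {set {set N}}) : finType :=
  (N + zoned_station Z)%type.

Definition resolved_adj (N : ptn) (Z : {set {set N}}) :
    rel (resolved_node Z) := fun u v =>
  match u, v with
  | inl x, inr c => x == (val c).1
  | inr c, inl x => x == (val c).1
  | inr c, inr d => adj (val c).1 (val d).1
  | inl _, inl _ => false
  end.

(* Only the values on edges matter. *)
Definition resolved_weight (N : ptn) (Z : {set {set N}})
    (u v : resolved_node Z) : nat :=
  match u, v with
  | inr c, inr d => zone_change (val c).2 (val d).2
  | _, _ => 1
  end.

Definition node_station (N : ptn) (Z : {set {set N}})
    (u : resolved_node Z) : N :=
  match u with inl x => x | inr c => (val c).1 end.

Fixpoint del_repeats (T : eqType) (s : seq T) : seq T :=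
  match s with
  | x :: ((y :: _) as s') => if x == y then del_repeats s' else x :: del_repeats s'
  | _ => s
  end.

(* The specification of the algorithm is a relation, since it depends on which
   shortest path of the overlaps-resolved graph is chosen. *)
Definition algorithm_result (N : ptn) (Z : {set {set N}}) (x y : N)
    (W : seq N) : Prop :=
  exists W' : seq (resolved_node Z),
    shortest_walk (@resolved_adj N Z) (@resolved_weight N Z) (inl x) (inl y) W'
    /\ W = del_repeats [seq node_station u | u <- W'].

Section Fares.
Local Open Scope ring_scope.

(* A price function on the integers [>= 1]; the value at [0] is irrelevant. *)
Definition price_function (R : realType) (P : nat -> R) : Prop :=
  forall k, (1 <= k)%N -> 0 <= P k.

Definition increasing_price (R : realType) (P : nat -> R) : Prop :=
  forall k l, (1 <= k)%N -> (k <= l)%N -> P k <= P l.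

Definition subadditive_price (R : realType) (P : nat -> R) : Prop :=
  forall k l, (1 <= k)%N -> (1 <= l)%N -> P (k + l)%N <= P k + P l.

(* Values outside the set of walks are irrelevant. *)
Definition fare_structure (N : ptn) (R : realType) (p : seq N -> R) : Prop :=
  forall W, is_walk (@adj N) W -> 0 <= p W.

Definition is_ZOA (N : ptn) (Z : {set {set N}}) (R : realType)
    (P : nat -> R) (p : seq N -> R) : Prop :=
  forall W, is_walk (@adj N) W -> p W = P (zone_count Z W).

Definition cheapest_path (N : ptn) (R : realType) (p : seq N -> R) (x y : N)
    (W : seq N) : Prop :=
  walk_between (@adj N) x y W /\
  forall W', walk_between (@adj N) x y W' -> p W <= p W'.

(* [is_concat W Ws]: [W] is obtained by joining the walks in [Ws] at their
   common end nodes, as in (x_1,..,x_i) + (x_i,..,x_n) = (x_1,..,x_n). *)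
Inductive is_concat (T : Type) : seq T -> seq (seq T) -> Prop :=
| ConcatOne W : is_concat W [:: W]
| ConcatCons u s s' Ws :
    is_concat (last u s :: s') Ws -> is_concat (u :: s ++ s') ((u :: s) :: Ws).

Definition is_ticket (N : ptn) (W : seq N) (T : seq (seq N)) : Prop :=
  all (is_walk (@adj N)) T /\
  exists Ws : seq (seq N),
    [/\ is_concat W Ws, all (is_walk (@adj N)) Ws
      & all2 (fun Wj Hj => infix Wj Hj) Ws T].

Definition standard_ticket (N : ptn) (W : seq N) : seq (seq N) := [:: W].

Definition ticket_price (N : ptn) (R : realType) (p : seq N -> R)
    (T : seq (seq N)) : R := \sum_(H <- T) p H.

Definition cheapest_ticket (N : ptn) (R : realType) (p : seq N -> R)
    (x y : N) (T : seq (seq N)) : Prop :=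
  (exists2 W, walk_between (@adj N) x y W & is_ticket W T) /\
  forall W' T', walk_between (@adj N) x y W' -> is_ticket W' T' ->
    ticket_price p T <= ticket_price p T'.

Definition cheapest_standard_ticket (N : ptn) (R : realType) (p : seq N -> R)
    (x y : N) (T : seq (seq N)) : Prop :=
  (exists2 W, walk_between (@adj N) x y W & T = standard_ticket W) /\
  forall W', walk_between (@adj N) x y W' ->
    ticket_price p T <= ticket_price p (standard_ticket W').

End Fares.

(* Structured programs for a random access machine: registers and arrays hold
   natural numbers, and every operation costs one unit of time. The only
   arithmetic is addition and truncated subtraction (in particular there is no
   multiplication), so numbers gain at most one bit per operation and running
   times agree with those of Turing machines up to a polynomial. *)

Inductive expr :=
| Cst of nat
| Reg of nat
| Cell of nat & expr
| Add of expr & expr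
| Sub of expr & expr.

Inductive cmd :=
| Skip
| SetReg of nat & expr
| SetCell of nat & expr & expr
| Seq of cmd & cmd
| If of expr & cmd & cmd
| While of expr & cmd.

Record state := State { reg : nat -> nat; arr : nat -> nat -> nat }.

Definition set_reg (s : state) (r v : nat) : state :=
  State (fun r' => if r' == r then v else reg s r') (arr s).

Definition set_cell (s : state) (a i v : nat) : state :=
  State (reg s)
    (fun a' i' => if (a' == a) && (i' == i) then v else arr s a' i').

Fixpoint eval (s : state) (e : expr) : nat :=
  match e with
  | Cst n => n
  | Reg r => reg s r
  | Cell a e1 => arr s a (eval s e1)
  | Add e1 e2 => eval s e1 + eval s e2
  | Sub e1 e2 => eval s e1 - eval s e2
  end.

Fixpoint eval_time (e : expr) : nat :=
  match e with
  | Cst _ | Reg _ => 1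
  | Cell _ e1 => (eval_time e1).+1
  | Add e1 e2 | Sub e1 e2 => (eval_time e1 + eval_time e2).+1
  end.

(* [exec c s t s']: started in [s], [c] halts after [t] steps in [s'].
   Conditions hold when their value is nonzero. *)
Inductive exec : cmd -> state -> nat -> state -> Prop :=
| ExecSkip s : exec Skip s 1 s
| ExecSetReg r e s :
    exec (SetReg r e) s (eval_time e).+1 (set_reg s r (eval s e))
| ExecSetCell a e1 e2 s :
    exec (SetCell a e1 e2) s (eval_time e1 + eval_time e2).+1
      (set_cell s a (eval s e1) (eval s e2))
| ExecSeq c1 c2 s t1 s1 t2 s2 :
    exec c1 s t1 s1 -> exec c2 s1 t2 s2 -> exec (Seq c1 c2) s (t1 + t2) s2
| ExecIfTrue e c1 c2 s t s' :
    eval s e != 0 -> exec c1 s t s' ->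
    exec (If e c1 c2) s ((eval_time e).+1 + t) s'
| ExecIfFalse e c1 c2 s t s' :
    eval s e = 0 -> exec c2 s t s' ->
    exec (If e c1 c2) s ((eval_time e).+1 + t) s'
| ExecWhileTrue e c s t1 s1 t2 s2 :
    eval s e != 0 -> exec c s t1 s1 -> exec (While e c) s1 t2 s2 ->
    exec (While e c) s ((eval_time e).+1 + t1 + t2) s2
| ExecWhileFalse e c s :
    eval s e = 0 -> exec (While e c) s (eval_time e).+1 s.

(* Input: registers 0 to 3 hold the number of stations, the number of zones and
   the indices of [x] and [y]; array 0 is the adjacency matrix and array 1 the
   zone-station incidence matrix, both in row-major order. Everything else is
   0. *)
Definition encode_input (N : ptn) (Z : {set {set N}}) (x y : N) : state :=
  State
    (nth 0 [:: #|N|; #|Z|; nat_of_ord (enum_rank x); nat_of_ord (enum_rank y)])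
    (fun a => nth 0 (nth [::]
       [:: [seq nat_of_bool (adj u v) | u <- enum N, v <- enum N];
           [seq nat_of_bool (v \in A) | A : {set N} <- enum Z, v : N <- enum N]] a)).

(* Output: a list of stations in array 2, with its length in register 4. *)
Definition outputs (N : ptn) (s : state) (W : seq N) : Prop :=
  mkseq (arr s 2) (reg s 4) = [seq nat_of_ord (enum_rank v) | v <- W].

Definition computes_within (N : ptn) (Z : {set {set N}}) (c : cmd) (x y : N)
    (W : seq N) (bound : nat) : Prop :=
  exists t s, [/\ exec c (encode_input Z x y) t s, t <= bound & outputs s W].

(* Main.v *)
Require Import Defs.
From mathcomp Require Import all_boot all_order all_algebra reals.
From mathcomp Require Import zify.

Set Implicit Arguments.
Unset Strict Implicit.
Unset Printing Implicit Defensive.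

Import Order.TTheory GRing.Theory Num.Theory.

(** Routes through the overlaps-resolved graph are paths together with an
    assignment of zones. A path with an optimal assignment lifts to a walk of
    weight [zone_count + 1]: one to enter the zone copies, one to leave them, and
    one for each zone change ([resolved_lift]). Conversely, a nontrivial walk of
    weight [w] projects to a path with at most [w - 1] zones
    ([resolved_project]). So the projection of a shortest walk has the least
    number of zones ([algorithm_result_min]), and it is a cheapest path because
    prices increase with the number of zones.

    A ticket of [W] covers consecutive subpaths of [W]. The number of zones is
    subadditive under concatenation ([zone_count_join]) and does not grow when
    one passes to a subpath ([zone_count_infix]), so that for a subadditive price
    function each ticket of [W] costs at least [P (zone_count W)]
    ([ticket_price_ge]). Hence a cheapest path is also a cheapest ticket.

    For the running time, the [M = n * (m + 1)] pairs of a station with a zone,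
    or with no zone, are numbered. A simple walk has at most [M] nodes and
    therefore weight less than [M], so dynamic programming over the number of
    edges finds the distances to the target within [M] rounds, and repeating its
    choices from the source on traces a shortest walk ([shortest_trace]). The
    machine program is written with bounded loops only. Such programs denote
    total functions on states, and their running time is a polynomial in the loop
    bounds that can be read off from the text ([exec_compile]); correctness is
    then a matter of loop invariants ([sem_for]) and does not mention time. *)

(** * Walks and their weights *)

Lemma walk_weight_cons2 (T : Type) (b : T -> T -> nat) u v s :
  walk_weight b (u :: v :: s) = b u v + walk_weight b (v :: s).
Proof. by []. Qed.

Lemma walk_weight_cat (T : Type) (b : T -> T -> nat) u s t :
  walk_weight b (u :: s ++ t) =
  walk_weight b (u :: s) + walk_weight b (last u s :: t).
Proof. by rewrite /walk_weight pairmap_cat sumn_cat. Qed.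

Lemma walk_weight_size (T : Type) (b : T -> T -> nat) (W : seq T) :
  (forall u v, b u v <= 1) -> walk_weight b W <= (size W).-1.
Proof.
move=> b_le1; case: W => // u s; elim: s u => // v s IH u.
by rewrite walk_weight_cons2 (leq_add (b_le1 u v) (IH v)).
Qed.

Lemma walk_between_is_walk (T : eqType) (e : rel T) x y W :
  walk_between e x y W -> is_walk e W.
Proof. by case: W => //= u s /and3P[]. Qed.

(** Cutting out the loop at a repeated node leaves a walk with the same ends
    and removes nonnegative weights only. *)
Lemma simple_walk (T : eqType) (e : rel T) (b : T -> T -> nat) x y W :
  walk_between e x y W ->
  exists W', [/\ walk_between e x y W', uniq W'
               & walk_weight b W' <= walk_weight b W].
Proof.
case: W => // u s /= /and3P[/eqP-> {u}].
elim: s x => [|v s IH] x /=.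
  by move=> _ xy; exists [:: x]; split=> //=; rewrite eqxx xy.
case/andP=> xv vs sy; have [[|v' V] [VW Vu Vw]] := IH v vs sy; first by [].
have /eqP Ev' := (andP VW).1; subst v'; have /and3P[_ pV lV] := VW.
have [xV | xV] := boolP (x \in v :: V); last first.
  exists (x :: v :: V); split=> /=.
  - by rewrite eqxx xv pV lV.
  - by rewrite xV; exact: Vu.
  - by rewrite leq_add2l.
have [p1 [p2 E]] : exists p1 p2, v :: V = p1 ++ x :: p2.
  by move E: (v :: V) xV => L xL; case/splitPr: xL E => p1 p2 _; exists p1, p2.
exists (x :: p2).
case: p1 E => [|v'' p1] /= [? ?].
  subst x p2; split=> //=; exact: leq_trans Vw (leq_addl _ _).
subst v'' V; move: pV lV Vu Vw.
rewrite cat_path last_cat /= => /and3P[p1p p1x xp2] lp.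
rewrite mem_cat cat_uniq => /and3P[_ _ /andP[_ /= xu]] Vw.
split=> //=; first by rewrite eqxx xp2 lp.
apply: leq_trans (leq_addl _ _); apply: leq_trans Vw.
rewrite -/(walk_weight b (v :: p1 ++ x :: p2)) walk_weight_cat.
by rewrite walk_weight_cons2 addnA; apply: leq_addl.
Qed.

Lemma del_repeats_cons (T : eqType) (x : T) s :
  del_repeats (x :: s) = x :: behead (del_repeats (x :: s)).
Proof.
elim: s x => // y s IH x /=; case: (x =P y) => [-> | //]; exact: IH.
Qed.

Lemma del_repeats_cons2 (T : eqType) (x y : T) s :
  del_repeats (x :: y :: s) =
  if x == y then del_repeats (y :: s) else x :: del_repeats (y :: s).
Proof. by []. Qed.

(** * Counting zones *)

Definition assigned (N : ptn) (Z : {set {set N}}) (W : seq N)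
    (h : seq {set N}) : bool :=
  all2 (fun v A => A \in zones Z v) W h.

Lemma assigned_size (N : ptn) (Z : {set {set N}}) W h :
  assigned Z W h -> size h = size W.
Proof. by rewrite /assigned all2E => /andP[/eqP]. Qed.

Lemma assigned_cat (N : ptn) (Z : {set {set N}}) W1 W2 h1 h2 :
  size h1 = size W1 ->
  assigned Z (W1 ++ W2) (h1 ++ h2) = assigned Z W1 h1 && assigned Z W2 h2.
Proof.
elim: W1 h1 => [|v W1 IH] [|A h1] //= [sz].
by rewrite /assigned /= -/(assigned _ _ _) IH // andbA.
Qed.

Lemma zones_neq0 (N : ptn) (Z : {set {set N}}) v :
  zone_cover Z -> exists A, A \in zones Z v.
Proof.
case=> _ covZ; have: v \in cover Z by rewrite covZ inE.
by case/bigcupP=> A AZ vA; exists A; rewrite inE AZ.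
Qed.

Lemma assigned_exists (N : ptn) (Z : {set {set N}}) W :
  zone_cover Z -> exists h, assigned Z W h.
Proof.
move=> covZ; elim: W => [|v W [h Wh]]; first by exists [::].
by have [A Av] := zones_neq0 v covZ; exists (A :: h); rewrite /= Av.
Qed.

Lemma zone_change_le1 (N : ptn) (A B : {set N}) : zone_change A B <= 1.
Proof. exact: leq_b1. Qed.

Lemma zone_change_triangle (N : ptn) (A B C : {set N}) :
  zone_change A C <= zone_change A B + zone_change B C.
Proof.
rewrite /zone_change; case: (A =P B) => [-> // | _].
exact: leq_trans (leq_b1 _) (leq_addr _ _).
Qed.

Lemma bigminn_le (I : eqType) (r : seq I) (P : pred I) (F : I -> nat) x i :
  i \in r -> P i -> \big[minn/x]_(j <- r | P j) F j <= F i.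
Proof.
move=> ir Pi; elim: r ir => // j r IH; rewrite inE big_cons.
case/predU1P=> [<- | /IH le_i]; first by rewrite Pi geq_minl.
by case: ifP => // _; rewrite geq_min le_i orbT.
Qed.

Lemma zone_count_le (N : ptn) (Z : {set {set N}}) W h :
  assigned Z W h -> zone_count Z W <= (walk_weight (@zone_change N) h).+1.
Proof.
move=> Wh; have sz : size h == size W.
  by rewrite (assigned_size Wh).
rewrite /zone_count add1n ltnS.
exact: (@bigminn_le _ _ _ _ _ (Tuple sz) (mem_index_enum _) Wh).
Qed.

(** An assignment has at most one change per edge, so the neutral element of the
    minimum does not undercut the assignments, of which there is one. *)
Lemma zone_count_attained (N : ptn) (Z : {set {set N}}) W :
  zone_cover Z ->
  exists2 h, assigned Z W h
    & zone_count Z W = (walk_weight (@zone_change N) h).+1.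
Proof.
move=> covZ; set P := fun h : seq {set N} => assigned Z W h.
have [h0 Wh0] := assigned_exists W covZ.
have sz0 := assigned_size Wh0.
have : zone_count Z W = (size W).-1.+1 \/
    exists2 h, assigned Z W h & zone_count Z W = (walk_weight (@zone_change N) h).+1.
  rewrite /zone_count add1n; elim/big_rec: _ => [|h k Wh IH]; first by left.
  case: (leqP (walk_weight (@zone_change N) h) k) => _; first by right; exists h.
  exact: IH.
case=> [Emax | //]; exists h0 => //; apply/eqP; rewrite eqn_leq zone_count_le //.
rewrite Emax ltnS -sz0; apply: walk_weight_size; exact: zone_change_le1.
Qed.

Lemma zone_count_gt0 (N : ptn) (Z : {set {set N}}) W : 0 < zone_count Z W.
Proof. by []. Qed.

Lemma zone_count1 (N : ptn) (Z : {set {set N}}) x :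
  zone_cover Z -> zone_count Z [:: x] = 1.
Proof.
case/(zone_count_attained [:: x]) => h /assigned_size sz ->.
by case: h sz => [|A []].
Qed.

(** Restricting an assignment to a subpath only loses zone changes. *)
Lemma zone_count_infix (N : ptn) (Z : {set {set N}}) W H :
  zone_cover Z -> infix W H -> zone_count Z W <= zone_count Z H.
Proof.
move=> covZ /infixP[s1 [s2 ->]].
have [h Hh ->] := zone_count_attained (s1 ++ W ++ s2) covZ.
have szh : size h = size s1 + (size W + size s2).
  by rewrite (assigned_size Hh) !size_cat.
move: Hh; rewrite -(cat_take_drop (size s1) h) assigned_cat ?size_takel ?szh ?leq_addr //.
case/andP=> _; set k := drop _ h.
have szk : size k = size W + size s2 by rewrite size_drop szh addKn.
rewrite -(cat_take_drop (size W) k) assigned_cat ?size_takel ?szk ?leq_addr //.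
case/andP=> Wk _; apply: leq_trans (zone_count_le Wk) _; rewrite ltnS.
move: (take _ h) (drop _ k) (take _ k) => t1 t2 t {Wk szk k szh h}.
have pre (s t' : seq {set N}) : walk_weight (@zone_change N) s
      <= walk_weight (@zone_change N) (s ++ t').
  by case: s => // A s; rewrite cat_cons walk_weight_cat leq_addr.
apply: leq_trans (pre t t2) _; case: t1 => // A t1.
rewrite cat_cons walk_weight_cat; case: (t ++ t2) => // B r.
by rewrite walk_weight_cons2 addnA leq_addl.
Qed.

(** Assignments of two consecutive subpaths may disagree at the common node.
    Joining them creates at most one zone change there, which the summand 1 of
    the second zone count pays for. *)
Lemma zone_count_join (N : ptn) (Z : {set {set N}}) u s s' :
  zone_cover Z ->
  zone_count Z (u :: s ++ s') <=
  zone_count Z (u :: s) + zone_count Z (last u s :: s').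
Proof.
move=> covZ.
have [[|A h] // /andP[Au Ah] ->] := zone_count_attained (u :: s) covZ.
have [[|B k] // /andP[_ Bk] ->] := zone_count_attained (last u s :: s') covZ.
have Wh : assigned Z (u :: s ++ s') (A :: h ++ k).
  have sz : size h = size s by exact: assigned_size Ah.
  by rewrite -!cat_cons assigned_cat /= ?sz //; apply/andP; split=> //; apply/andP.
apply: leq_trans (zone_count_le Wh) _.
rewrite walk_weight_cat addSn ltnS leq_add2l; case: k {Bk Wh} => // C k.
by rewrite !walk_weight_cons2; have := zone_change_le1 (last A h) C; lia.
Qed.

(** * Walks of the overlaps-resolved graph *)

(** An assignment of [W] is a route through the copies of its stations; entering
    and leaving the copies costs 2, and each zone change costs 1. *)
Lemma resolved_lift (N : ptn) (Z : {set {set N}}) x y W h :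
  walk_between (@adj N) x y W -> assigned Z W h ->
  exists2 W', walk_between (@resolved_adj N Z) (inl x) (inl y) W'
    & walk_weight (@resolved_weight N Z) W' =
      (walk_weight (@zone_change N) h).+2.
Proof.
move=> xy Wh; have [cs [csW csh]] : exists cs : seq (zoned_station Z),
    [seq (val c).1 | c <- cs] = W /\ [seq (val c).2 | c <- cs] = h.
  elim: W h Wh {xy} => [|v W IH] [|A h] //=; first by exists [::].
  case/andP=> Av /IH[cs [<- <-]].
  by exists (exist (fun c : N * {set N} => c.2 \in zones Z c.1) (v, A) Av :: cs).
case: cs csW csh => [|c cs] /= Wcs <- {h Wh}; first by rewrite -Wcs in xy.
move: xy; rewrite -{W}Wcs => /= /and3P[/eqP<- {x} Wp /eqP<-] {y}.
rewrite (last_map (fun c : zoned_station Z => (val c).1)).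
exists (inl (val c).1 :: inr c :: rcons (map inr cs) (inl (val (last c cs)).1)).
  rewrite /= !eqxx /= rcons_path !last_rcons (last_map inr) /= !eqxx !andbT.
  by elim: cs c Wp => //= d cs IH c /andP[-> /IH].
rewrite walk_weight_cons2 /= -cats1 pairmap_cat sumn_cat (last_map inr) /=.
rewrite addn0 add1n addn1; congr (_.+2).
by elim: cs c {Wp} => //= d cs IH c; rewrite IH.
Qed.

Lemma resolved_project_walk (N : ptn) (Z : {set {set N}}) u s :
  path (@resolved_adj N Z) u s ->
  walk_between (@adj N) (node_station u) (node_station (last u s))
    (del_repeats [seq node_station w | w <- u :: s]).
Proof.
elim: s u => [|v s IH] u; first by rewrite /= !eqxx.
case/andP=> uv /IH{IH}; rewrite [map _ (u :: _)]/= del_repeats_cons2.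
rewrite [last u _]/=; have [-> // | nuv] := eqVneq (node_station u) _.
rewrite [map _ (v :: _)]/= del_repeats_cons => /= /and3P[_ -> ->].
rewrite eqxx !andbT; case: u v uv nuv => [x|c] [z|d] //=.
  by move=> /eqP-> /eqP.
by move=> /eqP-> /eqP.
Qed.

#[local] Arguments walk_weight : simpl never.

(** Each station of the projected path is assigned the zone of the last copy
    in its block. A visit to an original station between two copies costs 2,
    which pays for the zone change it may hide. If the walk starts at a copy,
    the zone of that copy is prefixed to the assignment, so that an edge in front
    of the walk can be charged with a change to the next zone in use. *)
Lemma resolved_project (N : ptn) (Z : {set {set N}}) y u s :
  path (@resolved_adj N Z) u s -> last u s = inl y -> s != [::] ->
  exists2 h, assigned Z (del_repeats [seq node_station w | w <- u :: s]) h
    & match u with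
      | inl _ => (walk_weight (@zone_change N) h).+2
      | inr c => (walk_weight (@zone_change N) ((val c).2 :: h)).+1
      end <= walk_weight (@resolved_weight N Z) (u :: s).
Proof.
have change_head A B h : walk_weight (@zone_change N) (A :: h) <=
    zone_change A B + walk_weight (@zone_change N) (B :: h).
  case: h => // C h; rewrite !walk_weight_cons2 addnA leq_add2r.
  exact: zone_change_triangle.
have change_tail A h : walk_weight (@zone_change N) h <=
    walk_weight (@zone_change N) (A :: h).
  by case: h => // B h; rewrite walk_weight_cons2 leq_addl.
have change_cons A h : walk_weight (@zone_change N) (A :: h) <=
    (walk_weight (@zone_change N) h).+1.
  case: h => // B h; rewrite walk_weight_cons2 -add1n leq_add2r.
  exact: zone_change_le1.
have change0 A : @zone_change N A A = 0 by rewrite /zone_change eqxx.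
elim: s u => // v s IH u /andP[uv vs] /= sy _.
have [s0 | s_neq0] := eqVneq s [::].
  rewrite {s IH vs}s0 /= in sy *; rewrite {v}sy in uv *.
  case: u uv => //= c /eqP->; rewrite eqxx; exists [:: (val c).2].
    by rewrite /assigned /= (valP c).
  by rewrite !walk_weight_cons2 /= change0.
have [h vsh le_h] := IH v vs sy s_neq0; move: vsh.
rewrite walk_weight_cons2 [map _ (v :: s)]/=.
case: u v uv le_h {IH vs sy} => [x|c] [z|d] //= uv le_h vsh.
- move/eqP: uv => uv; subst; rewrite eqxx; exists h => //.
  by move: (change_tail (val d).2 h) le_h => /=; lia.
- move/eqP: uv => uv; subst; rewrite eqxx; exists h => //.
  by move: (change_cons (val c).2 h) le_h => /=; lia.
have nuv : (val c).1 != (val d).1.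
  by apply: contraTneq uv => ->; rewrite adj_irr.
rewrite (negPf nuv); exists ((val c).2 :: h).
  by rewrite /assigned /= (valP c).
by move: (change_head (val c).2 (val d).2 h) le_h; rewrite walk_weight_cons2 /= change0; lia.
Qed.

(** * Cheapest paths and cheapest tickets *)

(** The weight of a walk between distinct stations exceeds the number of zones
    by at least one, with equality for a path lifted along an optimal assignment,
    so that minimizing the weight minimizes the number of zones. The trivial walk has a single zone. *)
Lemma algorithm_result_min (N : ptn) (Z : {set {set N}}) x y W :
  zone_cover Z -> algorithm_result Z x y W ->
  walk_between (@adj N) x y W /\
  forall W', walk_between (@adj N) x y W' -> zone_count Z W <= zone_count Z W'.
Proof.
move=> covZ [V [[Vxy Vmin] ->{W}]].
case: V Vxy Vmin => // u s /= /and3P[/eqP-> us /eqP sy] Vmin.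
split; first by have := resolved_project_walk us; rewrite sy.
move=> W' W'xy; have [s0 | s_neq0] := eqVneq s [::].
  by rewrite s0 [map _ _]/= zone_count1 ?zone_count_gt0.
have [h Wh le_h] := resolved_project us sy s_neq0.
have [h' W'h' ->] := zone_count_attained W' covZ.
have [V' V'xy V'h'] := resolved_lift W'xy W'h'.
by move: (zone_count_le Wh) (Vmin V' V'xy) le_h; rewrite V'h' /=; lia.
Qed.

Section Fares.
Local Open Scope ring_scope.

Lemma algorithm_result_cheapest (N : ptn) (Z : {set {set N}}) (R : realType)
    (P : nat -> R) (p : seq N -> R) x y W :
  zone_cover Z -> increasing_price P -> is_ZOA Z P p ->
  algorithm_result Z x y W -> cheapest_path p x y W.
Proof.
move=> covZ P_incr pP /(algorithm_result_min covZ)[Wxy Wmin].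
split=> // W' W'xy; rewrite !pP ?(walk_between_is_walk Wxy)
  ?(walk_between_is_walk W'xy) //.
exact/P_incr/Wmin.
Qed.

Lemma cheapest_path_standard_ticket (N : ptn) (R : realType) (p : seq N -> R)
    x y W :
  cheapest_path p x y W ->
  cheapest_standard_ticket p x y (standard_ticket W).
Proof.
case=> Wxy Wmin; split; first by exists W.
by move=> W' W'xy; rewrite /ticket_price !big_seq1; exact: Wmin.
Qed.

(** Induction on the pieces of [W]: subadditivity of [P] splits off the price of
    one piece, which is at most that of the path it is a part of. *)
Lemma ticket_price_ge (N : ptn) (Z : {set {set N}}) (R : realType)
    (P : nat -> R) (p : seq N -> R) W T :
  zone_cover Z -> increasing_price P -> subadditive_price P -> is_ZOA Z P p ->
  is_ticket W T -> P (zone_count Z W) <= ticket_price p T.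
Proof.
move=> covZ P_incr P_sub pP [Twalk [Ws [WWs _ WsT]]].
have P_infix V H : is_walk (@adj N) H -> infix V H ->
    P (zone_count Z V) <= p H.
  by move=> Hw VH; rewrite pP //; apply/P_incr => //; exact: zone_count_infix.
elim: WWs T Twalk WsT => {W Ws} [W | u s s' Ws _ IH] [|H T] //.
  case: T => [|? ?] /=; last by rewrite andbF.
  by rewrite !andbT /ticket_price big_seq1; exact: P_infix.
move=> /= /andP[Hw Tw] /andP[sH WsT]; rewrite /ticket_price big_cons.
apply: le_trans (lerD (P_infix _ _ Hw sH) (IH T Tw WsT)).
apply: le_trans (P_sub _ _ _ _) => //; apply/P_incr => //.
exact: zone_count_join.
Qed.

Lemma cheapest_path_ticket (N : ptn) (Z : {set {set N}}) (R : realType)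
    (P : nat -> R) (p : seq N -> R) x y W :
  zone_cover Z -> increasing_price P -> subadditive_price P -> is_ZOA Z P p ->
  cheapest_path p x y W -> cheapest_ticket p x y (standard_ticket W).
Proof.
move=> covZ P_incr P_sub pP [Wxy Wmin]; have Ww := walk_between_is_walk Wxy.
split.
  exists W => //; split; first by rewrite /= Ww.
  exists [:: W]; split=> //=; [exact: ConcatOne | by rewrite Ww | ].
  by rewrite infix_refl.
move=> W' T' W'xy W'T'; rewrite /ticket_price big_seq1.
apply: le_trans (Wmin W' W'xy) _; rewrite pP ?(walk_between_is_walk W'xy) //.
exact: (ticket_price_ge covZ P_incr P_sub pP W'T').
Qed.

End Fares.

(** * Shortest walks by dynamic programming *)

Section Search.
Variables (M : nat) (e : rel nat) (b : nat -> nat -> nat) (y : nat).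
Hypothesis e_lt : forall q q', e q q' -> q' < M.
Hypothesis b_le1 : forall q q', b q q' <= 1.

(** The best way to move on from [q] to [q] itself or to a neighbour below [j],
    if [f] rates the places reached: the rating that is left, and the place
    chosen. Staying is an option in order that the ratings never decrease from
    one round to the next and that there always is a choice that attains the
    rating. *)
Fixpoint best (f : nat -> nat) (q j : nat) : nat * nat :=
  if j is i.+1 then
    let r := best f q i in
    if e q i && (r.1 < f i - b q i) then (f i - b q i, i) else r
  else (f q, q).

(** The part of an initial budget [M] that is left after the cheapest walk
    with at most [k] edges from [q] to [y] is paid for, and 0 if there is no
    such walk that costs less than [M]. Storing what is left in place of the
    distance makes 0 the infinite distance, which agrees with truncated
    subtraction and with the initial content of the memory. *)
Fixpoint budget (k q : nat) : nat :=
  if k is i.+1 then (best (budget i) q M).1 else if q == y then M else 0.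

(** The choices made in computing [budget k q], computed anew from the budgets.
    A choice to stay contributes no node. *)
Fixpoint trace (k q : nat) : seq nat :=
  if k is i.+1 then
    let a := (best (budget i) q M).2 in
    if a == q then trace i q else q :: trace i a
  else [:: q].

Lemma best_ge f q j : f q <= (best f q j).1.
Proof.
elim: j => //= j IH; case: ifP => //= /andP[_ lt_f].
exact: leq_trans IH (ltnW lt_f).
Qed.

Lemma best_max f q j i : i < j -> e q i -> f i - b q i <= (best f q j).1.
Proof.
move=> + qi; elim: j => // j IH; rewrite ltnS leq_eqVlt => /predU1P[ij | ij] /=.
  by rewrite -ij qi /=; case: ltnP.
case: ifP => //= [/andP[_ lt_f]|_]; last exact: IH.
exact: leq_trans (IH ij) (ltnW lt_f).
Qed.

Lemma best_attained f q j :
  let r := best f q j in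
  r.2 = q /\ r.1 = f q \/
  [/\ e q r.2, r.1 = f r.2 - b q r.2, f q < r.1 & r.2 < j].
Proof.
elim: j => [|j IH] /=; first by left.
case: ifP => [/andP[qj lt_f] | _].
  right; split=> //=; exact: leq_ltn_trans (best_ge _ _ _) lt_f.
by case: IH => [|[? ? ? ?]]; [left | right; split=> //; exact: ltnW].
Qed.

Lemma budget_walk k q s :
  path e q s -> last q s = y -> size s <= k ->
  M - walk_weight b (q :: s) <= budget k q.
Proof.
elim: k q s => [|k IH] q s.
  by case: s => // _ /= <- _; rewrite eqxx leq_subr.
case: s => [|q' s] /=.
  by move=> _ qy _; apply: leq_trans (best_ge _ _ _); exact: (IH q [::]).
case/andP=> qq' q's sy sk.
apply: leq_trans (best_max _ (e_lt qq') qq').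
by rewrite walk_weight_cons2 addnC subnDA leq_sub2r // IH.
Qed.

Lemma trace_cons k q : trace k q = q :: behead (trace k q).
Proof. by elim: k q => //= k IH q; case: eqP. Qed.

(** A positive budget is left only if no truncated subtraction on the way
    lost anything, hence what is left and the weight add up to [M]; and the
    walk ends at [y], as no other node starts with a positive budget. *)
Lemma trace_walk k q : 0 < budget k q ->
  walk_between e q y (trace k q) /\
  budget k q + walk_weight b (trace k q) = M.
Proof.
elim: k q => [|k IH] q /=.
  by case: eqP => // -> _; rewrite /walk_weight /= addn0 !eqxx.
case: (best_attained (budget k) q M) => /=.
  by case=> -> ->; rewrite eqxx; exact: IH.
set r := best _ q M => -[qr Er lt_r r2M] r_gt0.
have r_neq : r.2 == q = false.
  apply/eqP=> r2q; move: lt_r; rewrite Er r2q.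
  by move: (leq_subr (b q q) (budget k q)); lia.
have [|wr Ew] := IH r.2; first by lia.
rewrite r_neq; move: wr Ew; rewrite trace_cons /= => /and3P[_ -> ->] Ew.
rewrite eqxx qr walk_weight_cons2; split=> //; lia.
Qed.

Lemma path_lt q s : path e q s -> all (fun i => i < M) s.
Proof. by elim: s q => //= i s IH q /andP[/e_lt-> /IH]. Qed.

(** All walks can be made simple, after which they are covered by [M] rounds
    and do not exhaust the budget [M]. *)
Lemma shortest_trace x :
  x < M -> (exists W, walk_between e x y W) ->
  shortest_walk e b x y (trace M x).
Proof.
move=> xM [W Wxy]; have M_gt0 : 0 < M by exact: leq_ltn_trans xM.
have simple W' : walk_between e x y W' -> exists V : seq nat,
    [/\ M - walk_weight b V <= budget M x, walk_weight b V < M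
      & walk_weight b V <= walk_weight b W'].
  case/(simple_walk b) => -[|u s] [] // Vxy Vu Vw; exists (u :: s).
  have /and3P[/eqP ux us /eqP sy] := Vxy; rewrite {u Vxy}ux in us sy Vu Vw *.
  have szs : size s < M.
    rewrite -[M](size_iota 0); apply: (@uniq_leq_size _ (x :: s)) => // q.
    rewrite mem_iota add0n inE => /predU1P[-> //|]; exact: (allP (path_lt us)).
  split=> //; first by apply: budget_walk => //; exact: ltnW.
  by apply: leq_ltn_trans szs; exact: walk_weight_size.
have [V [leV ltV _]] := simple W Wxy.
have [|txy Et] := @trace_walk M x; first by lia.
split=> // W' /simple[V' [leV' _ leV'']]; apply: leq_trans _ leV''.
by rewrite -(leq_add2l (budget M x)) Et addnC -leq_subLR.
Qed.

End Search.

(** * Programs with bounded loops *)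

(** [PFor i n p] runs [p] with register [i] counting from 0 up to the value of
    register [n]. Such programs always halt, so they have a total semantics
    [sem], and a bound on the loop registers bounds their running time. *)
Inductive prog :=
| PSkip
| PSet of nat & expr
| PStore of nat & expr & expr
| PSeq of prog & prog
| PIf of expr & prog & prog
| PFor of nat & nat & prog.

Fixpoint compile (p : prog) : cmd :=
  match p with
  | PSkip => Skip
  | PSet r e => SetReg r e
  | PStore a e1 e2 => SetCell a e1 e2
  | PSeq p1 p2 => Seq (compile p1) (compile p2)
  | PIf e p1 p2 => If e (compile p1) (compile p2)
  | PFor i n p1 =>
      Seq (SetReg i (Cst 0))
        (While (Defs.Sub (Reg n) (Reg i))
           (Seq (compile p1) (SetReg i (Add (Reg i) (Cst 1)))))
  end.

Fixpoint sem (p : prog) (s : state) : state :=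
  match p with
  | PSkip => s
  | PSet r e => set_reg s r (eval s e)
  | PStore a e1 e2 => set_cell s a (eval s e1) (eval s e2)
  | PSeq p1 p2 => sem p2 (sem p1 s)
  | PIf e p1 p2 => if eval s e != 0 then sem p1 s else sem p2 s
  | PFor i n p1 =>
      iter (reg s n)
        (fun s' => let s1 := sem p1 s' in set_reg s1 i (reg s1 i + 1))
        (set_reg s i 0)
  end.

Fixpoint written_regs (p : prog) : seq nat :=
  match p with
  | PSkip | PStore _ _ _ => [::]
  | PSet r _ => [:: r]
  | PSeq p1 p2 | PIf _ p1 p2 => written_regs p1 ++ written_regs p2
  | PFor i _ p1 => i :: written_regs p1
  end.

Fixpoint written_arrs (p : prog) : seq nat :=
  match p with
  | PSkip | PSet _ _ => [::]
  | PStore a _ _ => [:: a]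
  | PSeq p1 p2 | PIf _ p1 p2 => written_arrs p1 ++ written_arrs p2
  | PFor _ _ p1 => written_arrs p1
  end.

(** A compiled loop tests its bound and its counter anew in each round, so it
    runs as often as [sem] says only if its body changes neither. *)
Fixpoint bounded_by (B : seq nat) (p : prog) : bool :=
  match p with
  | PSkip | PStore _ _ _ => true
  | PSet r _ => r \notin B
  | PSeq p1 p2 | PIf _ p1 p2 => bounded_by B p1 && bounded_by B p2
  | PFor i n p1 =>
      [&& n \in B, i \notin B, i \notin written_regs p1 & bounded_by B p1]
  end.

(** Here ['X] stands for a bound on the loop registers. A loop takes 2 steps to
    reset its counter, 4 for each test of its guard, the last one included, and
    4 to increase the counter. *)
Fixpoint cost (p : prog) : {poly nat} :=
  match p with
  | PSkip => polyC 1%N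
  | PSet _ e => polyC (eval_time e).+1
  | PStore _ e1 e2 => polyC (eval_time e1 + eval_time e2).+1
  | PSeq p1 p2 => (cost p1 + cost p2)%R
  | PIf e p1 p2 => (polyC (eval_time e).+1 + (cost p1 + cost p2))%R
  | PFor _ _ p1 => (polyC 6%N + 'X * (cost p1 + polyC 8%N))%R
  end.

Lemma bounded_by_written B p r : bounded_by B p -> r \in B -> r \notin written_regs p.
Proof.
elim: p => //= [i e | p1 IH1 p2 IH2 | e p1 IH1 p2 IH2 | i n p1 IH1].
- by rewrite inE => iB rB; apply: contraNneq iB => <-.
- by case/andP=> /IH1 r1 /IH2 r2 rB; rewrite mem_cat negb_or r1 ?r2.
- by case/andP=> /IH1 r1 /IH2 r2 rB; rewrite mem_cat negb_or r1 ?r2.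
case/and4P=> _ iB _ /IH1 r1 rB; rewrite inE negb_or r1 // andbT.
by apply: contraNneq iB => <-.
Qed.

Lemma sem_reg p s r : r \notin written_regs p -> reg (sem p s) r = reg s r.
Proof.
elim: p s => //= [i e | p1 IH1 p2 IH2 | e p1 IH1 p2 IH2 | i n p1 IH1] s.
- by rewrite inE => /negPf->.
- by rewrite mem_cat negb_or => /andP[r1 r2]; rewrite IH2 // IH1.
- by rewrite mem_cat negb_or => /andP[r1 r2]; case: ifP => _; rewrite ?IH1 ?IH2.
rewrite inE negb_or => /andP[/negPf ri r1].
by elim: (reg s n) => [|j IHj] /=; rewrite ri // IH1.
Qed.

Lemma sem_arr p s a : a \notin written_arrs p -> arr (sem p s) a = arr s a.
Proof.
elim: p s => //= [c e1 e2 | p1 IH1 p2 IH2 | e p1 IH1 p2 IH2 | i n p1 IH1] s.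
- by rewrite inE => /negPf->.
- by rewrite mem_cat negb_or => /andP[r1 r2]; rewrite IH2 // IH1.
- by rewrite mem_cat negb_or => /andP[r1 r2]; case: ifP => _; rewrite ?IH1 ?IH2.
by move=> a1; elim: (reg s n) => [|j IHj] //=; rewrite IH1.
Qed.

Lemma exec_compile B p s N :
  bounded_by B p -> (forall n, n \in B -> reg s n <= N) ->
  exists2 t, t <= (cost p).[N]%R & exec (compile p) s t (sem p s).
Proof.
elim: p s => /= [|r e|a e1 e2|p1 IH1 p2 IH2|e p1 IH1 p2 IH2|i n p1 IH1] s.
- by exists 1; rewrite ?hornerC //; exact: ExecSkip.
- by exists (eval_time e).+1; rewrite ?hornerC //; exact: ExecSetReg.
- by exists (eval_time e1 + eval_time e2).+1; rewrite ?hornerC //; exact: ExecSetCell.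
- case/andP=> p1B p2B sB; have [t1 le1 ex1] := IH1 s p1B sB.
  have [|t2 le2 ex2] := IH2 (sem p1 s) p2B.
    by move=> n nB; rewrite sem_reg ?sB // (bounded_by_written p1B nB).
  exists (t1 + t2); last exact: ExecSeq ex1 ex2.
  by rewrite hornerD; exact: leq_add.
- case/andP=> p1B p2B sB; rewrite !hornerD hornerC.
  case: eqP => [e0 | /eqP e0] /=.
    have [t le_t ex] := IH2 s p2B sB; exists ((eval_time e).+1 + t).
      by rewrite leq_add2l; apply: leq_trans le_t (leq_addl _ _).
    exact: ExecIfFalse.
  have [t le_t ex] := IH1 s p1B sB; exists ((eval_time e).+1 + t).
    by rewrite leq_add2l; apply: leq_trans le_t (leq_addr _ _).
  exact: ExecIfTrue.
case/and4P=> nB iB ip1 p1B sB.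
have nn : (n == i) = false by apply/negbTE; apply: contraNneq iB => <-.
set body := fun s' : state => _; set loop := While _ _.
have loop_exec d s' : (forall n, n \in B -> reg s' n <= N) ->
    reg s' n = reg s' i + d ->
    exists2 t, t <= 4 + d * ((cost p1).[N]%R + 8) & exec loop s' t (iter d body s').
  elim: d s' => [|d IHd] s' s'B s'd.
    by exists 4 => //; apply: ExecWhileFalse; rewrite /= s'd addn0 subnn.
  have [t1 le1 ex1] := IH1 s' p1B s'B.
  have regB m : m \in B -> reg (body s') m = reg s' m.
    move=> mB; have mi : (m == i) = false.
      by apply/negbTE; apply: contraNneq iB => <-.
    by rewrite /= mi sem_reg // (bounded_by_written p1B mB).
  have [||t2 le2 ex2] := IHd (body s').
  - by move=> m mB; rewrite regB // s'B.
  - by rewrite regB // s'd /= eqxx sem_reg // addnAC addn1 addnS.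
  rewrite iterSr; exists (4 + (t1 + 4) + t2); first by rewrite mulSn; lia.
  apply: ExecWhileTrue ex2; first by rewrite /= s'd; lia.
  exact: (ExecSeq ex1 (ExecSetReg i (Add (Reg i) (Cst 1)) (sem p1 s'))).
have [|| t le_t ex] := loop_exec (reg s n) (set_reg s i 0).
- move=> m mB /=; have mi : (m == i) = false.
    by apply/negbTE; apply: contraNneq iB => <-.
  by rewrite mi sB.
- by rewrite /= nn eqxx.
exists (2 + t); last exact: (ExecSeq (ExecSetReg i (Cst 0) s) ex).
rewrite hornerD hornerM hornerX hornerD !hornerC.
apply: (@leq_trans (2 + (4 + reg s n * ((cost p1).[N]%R + 8)))).
  by rewrite leq_add2l.
by rewrite addnA leq_add2l leq_mul2r sB ?orbT.
Qed.

(** What the body does not write is constant throughout the loop. The rule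
    supplies these facts, so that invariants mention only what changes. *)
Lemma sem_for (I : nat -> state -> Prop) i n p s :
  i \notin written_regs p ->
  I 0 (set_reg s i 0) ->
  (forall j s', j < reg s n -> reg s' i = j ->
     (forall r, r \notin i :: written_regs p -> reg s' r = reg s r) ->
     (forall a, a \notin written_arrs p -> arr s' a = arr s a) ->
     I j s' -> I j.+1 (set_reg (sem p s') i j.+1)) ->
  I (reg s n) (sem (PFor i n p) s).
Proof.
move=> ip I0 IS /=; set body := fun s' => _.
suff: forall j, j <= reg s n -> let s' := iter j body (set_reg s i 0) in
    [/\ reg s' i = j,
        (forall r, r \notin i :: written_regs p -> reg s' r = reg s r),
        (forall a, a \notin written_arrs p -> arr s' a = arr s a) & I j s'].
  by case/(_ _ (leqnn _)).
elim=> [|j IH] jn.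
  split=> //=; first by rewrite eqxx.
  by move=> r; rewrite inE negb_or => /andP[/negPf->].
have [ri regs arrs Ij] := IH (ltnW jn).
have Ebody : body (iter j body (set_reg s i 0)) =
    set_reg (sem p (iter j body (set_reg s i 0))) i j.+1.
  by rewrite /body sem_reg // ri addn1.
rewrite iterS; set s' := iter j body _ in ri regs arrs Ij Ebody *.
split; rewrite Ebody /=; first by rewrite eqxx.
- move=> r r_i; have := r_i; rewrite inE negb_or => /andP[/negPf-> rp].
  by rewrite sem_reg // regs.
- by move=> a ap; rewrite sem_arr // arrs.
exact: IS.
Qed.

(** * The search on coded nodes *)

Section Codes.
Variables (n M : nat) (A Inc : nat -> nat).

(** A number [l * n + v] with [v < n] codes the station [v] if [l = 0], and the
    copy of [v] in zone number [l - 1] otherwise. Not every number codes a node,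
    and [link] checks its second argument only: a search from a node stays
    among nodes. As the copies come after the [n] stations, subtracting [n] turns
    the code of a copy into its position in the incidence matrix. *)
Definition link (q q' : nat) : bool :=
  [&& q' < M, (q' < n) || (Inc (q' - n) != 0)
    & [&& q %/ n != 0, q' %/ n != 0 & A (n * (q %% n) + q' %% n) != 0]
      || (q %% n == q' %% n) && ((q %/ n == 0) != (q' %/ n == 0))].

Definition switch (q q' : nat) : nat := q %/ n != q' %/ n.

Lemma link_lt q q' : link q q' -> q' < M.
Proof. by case/and3P. Qed.

Lemma switch_le1 q q' : switch q q' <= 1.
Proof. exact: leq_b1. Qed.

End Codes.

#[local] Arguments sem : simpl never.

(** Unfolding [sem] one constructor at a time keeps loops folded, as [sem_for]
    requires. *)
Lemma sem_skip s : sem PSkip s = s. Proof. by []. Qed.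
Lemma sem_set r e s : sem (PSet r e) s = set_reg s r (eval s e).
Proof. by []. Qed.
Lemma sem_store a e1 e2 s :
  sem (PStore a e1 e2) s = set_cell s a (eval s e1) (eval s e2).
Proof. by []. Qed.
Lemma sem_seq p1 p2 s : sem (PSeq p1 p2) s = sem p2 (sem p1 s).
Proof. by []. Qed.
Lemma sem_if e p1 p2 s :
  sem (PIf e p1 p2) s = if eval s e != 0 then sem p1 s else sem p2 s.
Proof. by []. Qed.
Definition semE := (sem_skip, sem_set, sem_store, sem_seq, sem_if).

(** Truth values are numbers, with every nonzero number true; [Add] serves as
    the disjunction. *)
Definition ENot e := Defs.Sub (Cst 1) e.
Definition EAnd e1 e2 := ENot (Add (ENot e1) (ENot e2)).
Definition EEq e1 e2 := ENot (Add (Defs.Sub e1 e2) (Defs.Sub e2 e1)).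

Lemma eval_not s e : eval s (ENot e) = (eval s e == 0).
Proof. by rewrite /ENot /=; case: (eval s e). Qed.

Lemma eval_and s e1 e2 :
  eval s (EAnd e1 e2) = (eval s e1 != 0) && (eval s e2 != 0).
Proof. by rewrite /EAnd /ENot /=; case: (eval s e1); case: (eval s e2). Qed.

Lemma eval_eq s e1 e2 : eval s (EEq e1 e2) = (eval s e1 == eval s e2).
Proof. by rewrite /EEq eval_not /= addn_eq0 !subn_eq0 -eqn_leq. Qed.

Lemma eval_cst s c : eval s (Cst c) = c. Proof. by []. Qed.
Lemma eval_reg s r : eval s (Reg r) = reg s r. Proof. by []. Qed.
Lemma eval_cell s a e : eval s (Cell a e) = arr s a (eval s e).
Proof. by []. Qed.
Lemma eval_add s e1 e2 : eval s (Add e1 e2) = eval s e1 + eval s e2.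
Proof. by []. Qed.
Lemma eval_sub s e1 e2 : eval s (Defs.Sub e1 e2) = eval s e1 - eval s e2.
Proof. by []. Qed.
Definition evalE :=
  (eval_not, eval_and, eval_eq, eval_cst, eval_reg, eval_cell, eval_add, eval_sub).
#[local] Arguments eval : simpl never.

(* Registers 0 to 4 and arrays 0 to 2 are those of the input and output format.
   Register [r_layer] holds the position in [a_budget] at which the layer in use
   starts; arrays [a_station], [a_zone] and [a_row] tabulate [q %% n], [q %/ n]
   and [n * (q %% n)], because expressions can neither divide nor multiply. *)
#[local] Notation r_stations := 0 (only parsing).
#[local] Notation r_zones := 1 (only parsing).
#[local] Notation r_source := 2 (only parsing).
#[local] Notation r_target := 3 (only parsing).
#[local] Notation r_length := 4 (only parsing).
#[local] Notation r_nodes := 5 (only parsing).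
#[local] Notation r_layer := 6 (only parsing).
#[local] Notation r_node := 7 (only parsing).
#[local] Notation r_next := 8 (only parsing).
#[local] Notation r_value := 9 (only parsing).
#[local] Notation r_choice := 10 (only parsing).
#[local] Notation r_step := 11 (only parsing).
#[local] Notation r_station := 12 (only parsing).
#[local] Notation r_zone := 13 (only parsing).
#[local] Notation r_row := 14 (only parsing).
#[local] Notation a_adj := 0 (only parsing).
#[local] Notation a_inc := 1 (only parsing).
#[local] Notation a_out := 2 (only parsing).
#[local] Notation a_station := 3 (only parsing).
#[local] Notation a_zone := 4 (only parsing).
#[local] Notation a_row := 5 (only parsing).
#[local] Notation a_budget := 6 (only parsing).

#[local] Notation "p ;; q" := (PSeq p q) (at level 60, right associativity).

Definition prog_nodes :=
  PSet r_nodes (Reg r_stations) ;;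
  PFor r_step r_zones (PSet r_nodes (Add (Reg r_nodes) (Reg r_stations))).

Definition prog_tables :=
  PSet r_station (Cst 0) ;; PSet r_zone (Cst 0) ;; PSet r_row (Cst 0) ;;
  PFor r_node r_nodes (
    PStore a_station (Reg r_node) (Reg r_station) ;;
    PStore a_zone (Reg r_node) (Reg r_zone) ;;
    PStore a_row (Reg r_node) (Reg r_row) ;;
    PSet r_station (Add (Reg r_station) (Cst 1)) ;;
    PSet r_row (Add (Reg r_row) (Reg r_stations)) ;;
    PIf (Defs.Sub (Reg r_stations) (Reg r_station)) PSkip (
      PSet r_station (Cst 0) ;; PSet r_row (Cst 0) ;;
      PSet r_zone (Add (Reg r_zone) (Cst 1)))).

Definition expr_link :=
  EAnd (Add (Defs.Sub (Reg r_stations) (Reg r_next))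
            (Cell a_inc (Defs.Sub (Reg r_next) (Reg r_stations))))
    (Add (EAnd (Cell a_zone (Reg r_node))
            (EAnd (Cell a_zone (Reg r_next))
               (Cell a_adj (Add (Cell a_row (Reg r_node))
                                (Cell a_station (Reg r_next))))))
         (EAnd (EEq (Cell a_station (Reg r_node)) (Cell a_station (Reg r_next)))
            (ENot (EEq (ENot (Cell a_zone (Reg r_node)))
                       (ENot (Cell a_zone (Reg r_next))))))).

Definition expr_candidate :=
  Defs.Sub (Cell a_budget (Add (Reg r_layer) (Reg r_next)))
    (ENot (EEq (Cell a_zone (Reg r_node)) (Cell a_zone (Reg r_next)))).

(** Filling the table takes the rating of the best move from [r_node], and
    tracing the route takes the move itself. *)
Definition prog_best :=
  PSet r_value (Cell a_budget (Add (Reg r_layer) (Reg r_node))) ;;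
  PSet r_choice (Reg r_node) ;;
  PFor r_next r_nodes (
    PIf (EAnd expr_link (Defs.Sub expr_candidate (Reg r_value)))
      (PSet r_value expr_candidate ;; PSet r_choice (Reg r_next)) PSkip).

(** Layer [k] of [a_budget] starts at [k * M] and holds [budget k]. The layers are
    filled in increasing order, and [r_layer] ends at the last one, where
    [prog_trace] begins its way back. *)
Definition prog_budget :=
  PSet r_layer (Cst 0) ;;
  PStore a_budget (Reg r_target) (Reg r_nodes) ;;
  PFor r_step r_nodes (
    PFor r_node r_nodes (
      prog_best ;;
      PStore a_budget (Add (Add (Reg r_layer) (Reg r_nodes)) (Reg r_node))
        (Reg r_value)) ;;
    PSet r_layer (Add (Reg r_layer) (Reg r_nodes))).

Definition prog_trace :=
  PSet r_node (Reg r_source) ;;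
  PStore a_out (Cst 0) (Cell a_station (Reg r_source)) ;;
  PSet r_length (Cst 1) ;;
  PFor r_step r_nodes (
    PSet r_layer (Defs.Sub (Reg r_layer) (Reg r_nodes)) ;;
    prog_best ;;
    PIf (EEq (Cell a_station (Reg r_node)) (Cell a_station (Reg r_choice))) PSkip (
      PStore a_out (Reg r_length) (Cell a_station (Reg r_choice)) ;;
      PSet r_length (Add (Reg r_length) (Cst 1))) ;;
    PSet r_node (Reg r_choice)).

Lemma sem_nodes s n m :
  reg s r_stations = n -> reg s r_zones = m ->
  reg (sem prog_nodes s) r_nodes = n * m.+1.
Proof.
move=> sn sm; rewrite /prog_nodes !semE !evalE; set s1 := set_reg _ _ _.
pose I j s' := reg s' r_nodes = n * j.+1.
suff: I (reg s1 r_zones)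
        (sem (PFor r_step r_zones (PSet r_nodes (Add (Reg r_nodes) (Reg r_stations)))) s1).
  by rewrite /I /= sm.
apply: (@sem_for I) => //; first by rewrite /I /= sn muln1.
move=> j s' _ _ regs _; rewrite /I !semE !evalE /= => ->.
by rewrite regs //= sn [RHS]mulnS addnC.
Qed.

Section Runs.
Variables (n M : nat) (A Inc : nat -> nat).
Hypothesis n_gt0 : 0 < n.

(** The part of the state that stays constant during the search. *)
Record ready (s : state) : Prop := Ready {
  ready_stations : reg s r_stations = n;
  ready_nodes : reg s r_nodes = M;
  ready_adj : arr s a_adj = A;
  ready_inc : arr s a_inc = Inc;
  ready_station : forall q, q < M -> arr s a_station q = q %% n;
  ready_zone : forall q, q < M -> arr s a_zone q = q %/ n;
  ready_row : forall q, q < M -> arr s a_row q = n * (q %% n)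
}.

Lemma ready_frame s s' :
  ready s ->
  (forall r, r \in [:: r_stations; r_nodes] -> reg s' r = reg s r) ->
  (forall a, a \in [:: a_adj; a_inc; a_station; a_zone; a_row] ->
     arr s' a = arr s a) ->
  ready s'.
Proof.
by case=> ? ? ? ? ? ? ? rs' as'; split; rewrite ?rs' ?as' // => q qM;
  rewrite ?as' //; eauto.
Qed.

(** The loop counts in base [n]: the station is the low digit, which is reset
    with a carry to the zone when it reaches [n]. *)
Lemma sem_tables s :
  reg s r_stations = n -> reg s r_nodes = M -> arr s a_adj = A ->
  arr s a_inc = Inc -> ready (sem prog_tables s).
Proof.
move=> sn sM sA sInc.
have loop_reg r : r \notin written_regs prog_tables ->
    reg (sem prog_tables s) r = reg s r by exact: sem_reg.
have loop_arr a : a \notin written_arrs prog_tables ->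
    arr (sem prog_tables s) a = arr s a by exact: sem_arr.
suff [Hs Hz Hr]: [/\ forall q, q < M -> arr (sem prog_tables s) a_station q = q %% n,
    forall q, q < M -> arr (sem prog_tables s) a_zone q = q %/ n
    & forall q, q < M -> arr (sem prog_tables s) a_row q = n * (q %% n)].
  by split=> //; rewrite ?loop_reg ?loop_arr.
rewrite /prog_tables !semE !evalE; set s1 := set_reg _ r_row _; set p := PSeq _ _.
pose I j s' := [/\ reg s' r_station = j %% n, reg s' r_zone = j %/ n,
  reg s' r_row = n * (j %% n)
  & forall q, q < j -> [/\ arr s' a_station q = q %% n,
      arr s' a_zone q = q %/ n & arr s' a_row q = n * (q %% n)]].
suff: I (reg s1 r_nodes) (sem (PFor r_node r_nodes p) s1).
  by rewrite /= sM => -[_ _ _ H]; split=> q /H[].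
apply: (@sem_for I) => //; first by split; rewrite /= ?mod0n ?div0n ?muln0.
move=> j s' _ s'j regs _ [s'st s'zn s'row tab].
have s'n : reg s' r_stations = n by rewrite regs.
have dvdS : (n %| j.+1) = ~~ (n - (j %% n).+1 != 0).
  rewrite negbK subn_eq0 {1}(divn_eq j n) -addnS dvdn_addr ?dvdn_mull //.
  apply/idP/idP => [/dvdn_leq-> // | le_n].
  by have /eqP<- : n == (j %% n).+1 by rewrite eqn_leq le_n ltn_mod.
have tabS q : q < j.+1 ->
    [/\ (if q == j then j %% n else arr s' a_station q) = q %% n,
        (if q == j then j %/ n else arr s' a_zone q) = q %/ n
      & (if q == j then n * (j %% n) else arr s' a_row q) = n * (q %% n)].
  by rewrite ltnS leq_eqVlt; case: eqP => [-> // | _] /= /tab.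
rewrite /I /p !semE !evalE /= s'j s'st s'zn s'row s'n.
have := modnS j n; have := divnS j n_gt0; rewrite dvdS !addn1.
case: (n - _ != 0) => /= -> ->; split=> //; rewrite ?muln0 //.
by rewrite [RHS]mulnS addnC.
Qed.

Lemma eval_link s q q' :
  ready s -> reg s r_node = q -> q < M -> reg s r_next = q' -> q' < M ->
  (eval s expr_link != 0) = link n M A Inc q q'.
Proof.
case=> sn sM sA sI st zn row sq qM sq' q'M.
rewrite /expr_link !evalE sn sI sA sq sq' !(st, zn, row) // /link q'M /=.
rewrite !eqb0 !negbK !addn_eq0 !eqb0 !negb_and !negbK subn_eq0 -ltnNge.
by rewrite !negb_or negbK; do 2!case: (_ %/ n == 0).
Qed.

Lemma eval_candidate s q q' :
  ready s -> reg s r_node = q -> q < M -> reg s r_next = q' -> q' < M ->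
  eval s expr_candidate = arr s a_budget (reg s r_layer + q') - switch n q q'.
Proof.
case=> sn sM sA sI st zn row sq qM sq' q'M.
by rewrite /expr_candidate !evalE sq sq' !zn // eqb0.
Qed.

Let step := best (link n M A Inc) (switch n).
Let bud := budget M (link n M A Inc) (switch n).
Let tra := trace M (link n M A Inc) (switch n).

Lemma sem_best s f q :
  ready s -> reg s r_node = q -> q < M ->
  (forall i, i < M -> arr s a_budget (reg s r_layer + i) = f i) ->
  reg (sem prog_best s) r_value = (step f q M).1 /\
  reg (sem prog_best s) r_choice = (step f q M).2.
Proof.
move=> rs sq qM sf; rewrite /prog_best !semE !evalE; set s1 := set_reg _ _ _.
set p := PIf _ _ _.
pose I j s' := reg s' r_value = (step f q j).1 /\ reg s' r_choice = (step f q j).2.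
suff: I (reg s1 r_nodes) (sem (PFor r_next r_nodes p) s1).
  by rewrite /= (ready_nodes rs).
apply: (@sem_for I) => //; first by rewrite /I /= sq sf.
move=> j s' + s'j regs arrs [vj cj]; rewrite /= (ready_nodes rs) => jM.
have rs' : ready s'.
  apply: ready_frame rs _ _ => [r | a].
    by rewrite !inE => /orP[] /eqP->; rewrite regs.
  by rewrite !inE; do ?case/orP; move/eqP=> ->; rewrite arrs.
have s'q : reg s' r_node = q by rewrite regs //= sq.
have s'f : arr s' a_budget (reg s' r_layer + j) = f j.
  by rewrite arrs // regs //= sf.
rewrite /I /p !semE eval_and (eval_link rs' s'q qM s'j jM).
rewrite (eval_sub s' expr_candidate) !eval_reg.
rewrite (eval_candidate rs' s'q qM s'j jM) s'f vj eqb0 negbK subn_eq0 -ltnNge /=.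
by case: ifP => _ //=; rewrite s'j.
Qed.

Lemma row_major_eq k q l i : q < M -> i < M ->
  (k * M + q == l * M + i) = (k == l) && (q == i).
Proof.
move=> qM iM; have M_gt0 : 0 < M by exact: leq_ltn_trans qM.
apply/eqP/andP=> [E | [/eqP-> /eqP->] //]; split; apply/eqP.
  by have /(congr1 (divn^~ M)) := E; rewrite !divnMDl // !divn_small // !addn0.
by have /(congr1 (modn^~ M)) := E; rewrite !modnMDl !modn_small.
Qed.

Lemma sem_budget s y :
  ready s -> reg s r_target = y -> y < M -> (forall i, arr s a_budget i = 0) ->
  let s' := sem prog_budget s in
  reg s' r_layer = M * M /\
  forall k q, k <= M -> q < M -> arr s' a_budget (k * M + q) = bud y k q.
Proof.
move=> rs sy yM s0; rewrite /prog_budget !semE !evalE; set s1 := set_cell _ _ _ _.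
set body := PFor r_node _ _; set p := PSeq body _.
pose I j s' := reg s' r_layer = j * M /\
  forall k q, k <= j -> q < M -> arr s' a_budget (k * M + q) = bud y k q.
suff: I (reg s1 r_nodes) (sem (PFor r_step r_nodes p) s1).
  by rewrite /= (ready_nodes rs).
apply: (@sem_for I) => //.
  split=> //= k q; rewrite leqn0 => /eqP-> qM.
  by rewrite sy (ready_nodes rs) s0.
move=> j s2 + s2j regs arrs [s2l tab]; rewrite /= (ready_nodes rs) => jM.
have rs2 : ready s2.
  apply: ready_frame rs _ _ => [r | a].
    by rewrite !inE => /orP[] /eqP->; rewrite regs.
  by rewrite !inE; do ?case/orP; move/eqP=> ->; rewrite arrs.
rewrite /p sem_seq semE !evalE sem_reg //.
set s3 := sem body s2.
(* The next layer is complete below [i], and the layers before it stay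
   complete. *)
pose J i s' := forall k q, k <= j.+1 -> q < M -> (k <= j) || (q < i) ->
  arr s' a_budget (k * M + q) = bud y k q.
have Js3 : J (reg s2 r_nodes) s3.
  rewrite /s3 /body; apply: (@sem_for J) => //.
    by move=> k q _ qM; rewrite orbF => /tab->.
  move=> i s' + s'i regs' arrs' Ji; rewrite (ready_nodes rs2) => iM.
  have rs' : ready s'.
    apply: ready_frame rs2 _ _ => [r | a].
      by rewrite !inE => /orP[] /eqP->; rewrite regs'.
    by rewrite !inE; do ?case/orP; move/eqP=> ->; rewrite arrs'.
  have s'l : reg s' r_layer = j * M by rewrite regs'.
  have layer_j k : k < M -> arr s' a_budget (reg s' r_layer + k) = bud y j k.
    by move=> kM; rewrite s'l Ji // leqnn.
  have [vi _] := sem_best rs' s'i iM layer_j.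
  rewrite /J sem_seq sem_store !evalE vi !(@sem_reg prog_best) //.
  rewrite s'i s'l (ready_nodes rs') /=.
  rewrite sem_arr // => k q kj qM kq; rewrite -mulSnr row_major_eq //.
  case: andP => [[/eqP-> /eqP->] // | neq]; apply: Ji => //; move: kq.
  case: (leqP k j) => //= jk; rewrite ltnS leq_eqVlt => /orP[qi|//].
  by case: neq; rewrite qi eqn_leq kj jk.
rewrite (ready_nodes rs2) in Js3; split.
  by rewrite /= (sem_reg (p := body)) // s2l mulSnr (ready_nodes rs2).
by move=> k q kj qM /=; apply: Js3; rewrite // qM orbT.
Qed.

Lemma sem_trace s x y :
  ready s -> reg s r_source = x -> x < M -> reg s r_layer = M * M ->
  (forall k q, k <= M -> q < M -> arr s a_budget (k * M + q) = bud y k q) ->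
  let s' := sem prog_trace s in
  mkseq (arr s' a_out) (reg s' r_length) =
  del_repeats [seq q %% n | q <- tra y M x].
Proof.
move=> rs sx xM sl tab; rewrite /prog_trace sem_seq sem_set sem_seq sem_store.
rewrite sem_seq sem_set !evalE; set s1 := set_reg _ r_length _; set p := PSeq _ _.
set goal := del_repeats _.
(* What is written so far ends with the current station, with which the
   remaining part of the result starts. *)
pose I j s' := [/\ reg s' r_layer = (M - j) * M, reg s' r_node < M &
  mkseq (arr s' a_out) (reg s' r_length) ++
    behead (del_repeats [seq q %% n | q <- tra y (M - j) (reg s' r_node)]) = goal].
suff: I (reg s1 r_nodes) (sem (PFor r_step r_nodes p) s1).
  rewrite /= (ready_nodes rs) /I subnn => -[_ _ <-].
  by rewrite /tra /= cats0.
apply: (@sem_for I) => //.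
  split; rewrite /= ?subn0 ?sx // (ready_station rs) //.
  by rewrite /goal /tra trace_cons [map _ _]/= [RHS]del_repeats_cons.
move=> j s2 + s2j regs arrs [s2l s2M out]; rewrite /= (ready_nodes rs) => jM.
have rs2 : ready s2.
  apply: ready_frame rs _ _ => [r | a].
    by rewrite !inE => /orP[] /eqP->; rewrite regs.
  by rewrite !inE; do ?case/orP; move/eqP=> ->; rewrite arrs.
rewrite /p sem_seq sem_set !evalE s2l (ready_nodes rs2).
set k := M - j.+1; have kM : (M - j) = k.+1 by rewrite /k subnSK.
rewrite kM mulSnr addnK in out *.
set s3 := set_reg s2 r_layer _; set q := reg s2 r_node in s2M out *.
have rs3 : ready s3 by case: rs2 => *; split.
have [_ ch] : reg (sem prog_best s3) r_value = (step (bud y k) q M).1 /\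
    reg (sem prog_best s3) r_choice = (step (bud y k) q M).2.
  apply: sem_best => // i iM; rewrite arrs // /s1 /= tab //; exact: leq_subr.
set a := (step _ q M).2 in ch.
have aM : a < M.
  rewrite /a; case: (best_attained (link n M A Inc) (switch n) (bud y k) q M).
    by case=> ->.
  by case=> /link_lt.
rewrite sem_seq; set s4 := sem prog_best s3.
rewrite sem_seq sem_if sem_set !evalE.
have rs4 : ready s4.
  apply: ready_frame rs3 _ _ => [r | c].
    by rewrite !inE => /orP[] /eqP->; rewrite sem_reg.
  by rewrite !inE; do ?case/orP; move/eqP=> ->; rewrite sem_arr.
have s4q : reg s4 r_node = q by rewrite /s4 sem_reg.
have s4l : reg s4 r_layer = k * M by rewrite /s4 sem_reg.
have s4len : reg s4 r_length = reg s2 r_length by rewrite /s4 sem_reg.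
have s4out : arr s4 a_out = arr s2 a_out by rewrite /s4 sem_arr.
rewrite ch s4q !(ready_station rs4) // eqb0 negbK.
have Etra : tra y k.+1 q = if a == q then tra y k q else q :: tra y k a by [].
case: ifP => [/eqP qa | /eqP qa].
  rewrite sem_skip; split; rewrite /= ?ch ?s4l ?s4len ?s4out // -out -/k.
  rewrite Etra; case: (eqVneq a q) => [-> // | _].
  rewrite /tra (trace_cons _ _ _ _ k a) ![map _ _]/= [in RHS]del_repeats_cons2.
  by rewrite -qa eqxx.
have aq : (a == q) = false by apply/eqP=> aq; case: qa; rewrite aq.
rewrite sem_seq sem_store sem_set !evalE ch (ready_station rs4) //.
split; rewrite /= ?ch ?s4l // -out -/k Etra aq s4len s4out addn1 mkseqS eqxx.
rewrite -cats1 -catA; congr (_ ++ _).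
  apply/eq_in_map => i; rewrite mem_iota add0n => /andP[_ i_len].
  by rewrite ltn_eqF.
rewrite /tra (trace_cons _ _ _ _ k a) ![map _ _]/= [in RHS]del_repeats_cons2.
by rewrite (introF eqP qa) [in RHS]del_repeats_cons.
Qed.

End Runs.

(** * Coding the overlaps-resolved graph *)

Lemma nth_allpairs (S T U : Type) (f : S -> T -> U) s t a b d i j :
  i < size s -> j < size t ->
  nth d [seq f u v | u <- s, v <- t] (i * size t + j) = f (nth a s i) (nth b t j).
Proof.
move=> + jt; elim: s i => // u s IH [|i] /= iS; rewrite nth_cat size_map.
  by rewrite jt (nth_map b).
rewrite mulSn -addnA ltnNge leq_addr /= addKn; exact: IH.
Qed.

Lemma del_repeats_map (T U : eqType) (f : T -> U) s :
  injective f -> del_repeats (map f s) = map f (del_repeats s).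
Proof.
move=> f_inj; elim: s => [|u [|v s] IH] //.
rewrite [map f _]/= !del_repeats_cons2 (inj_eq f_inj).
by rewrite -[f v :: _]/(map f (v :: s)) IH; case: ifP.
Qed.

Section Coding.
Variables (N : ptn) (Z : {set {set N}}) (x0 y0 : N).

Let n := #|N|.
Let m := #|Z|.
Let input := encode_input Z x0 y0.
Let linkZ := link n (n * m.+1) (arr input a_adj) (arr input a_inc).

Definition station_number (v : N) : nat := enum_rank v.

Definition zone_number (u : resolved_node Z) : nat :=
  match u with inl _ => 0 | inr c => (index (val c).2 (enum Z)).+1 end.

Definition code (u : resolved_node Z) : nat :=
  zone_number u * n + station_number (node_station u).

Lemma station_number_lt v : station_number v < n.
Proof. exact: ltn_ord. Qed.

Lemma station_number_inj : injective station_number.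
Proof. by move=> u v /ord_inj /enum_rank_inj. Qed.

Lemma stations_gt0 : 0 < n.
Proof. exact: leq_ltn_trans (station_number_lt x0). Qed.

Lemma code_mod u : code u %% n = station_number (node_station u).
Proof. by rewrite modnMDl modn_small // station_number_lt. Qed.

Lemma code_div u : code u %/ n = zone_number u.
Proof.
by rewrite divnMDl ?stations_gt0 // divn_small ?addn0 // station_number_lt.
Qed.

Lemma zone_mem (c : zoned_station Z) : (val c).2 \in enum Z.
Proof. by have := valP c; rewrite mem_enum inE => /andP[]. Qed.

Lemma zone_number_le u : zone_number u <= m.
Proof. by case: u => //= c; rewrite /m cardE index_mem zone_mem. Qed.

Lemma code_lt u : code u < n * m.+1.
Proof.
rewrite mulnS addnC [n * m]mulnC;
apply: leq_ltn_trans (_ : m * n + station_number (node_station u) < _).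
  by rewrite leq_add2r leq_mul2r zone_number_le orbT.
by rewrite ltn_add2l station_number_lt.
Qed.

Lemma code_inj : injective code.
Proof.
move=> u v uv; have := code_mod u; have := code_div u.
rewrite uv code_div code_mod => zuv /station_number_inj.
case: u v uv zuv => [x|c] [y|d] _ //=; first by move=> _ ->.
case=> /(congr1 (nth set0 (enum Z))); rewrite !nth_index ?zone_mem // => E2 E1.
by congr inr; apply/val_inj/esym; case: c d E1 E2 => -[v A] ? [[w B] ?] /= -> ->.
Qed.

Lemma input_adj u v :
  arr input a_adj (n * station_number u + station_number v) = adj u v.
Proof.
rewrite /input /= mulnC /n cardE (nth_allpairs _ u v) -?cardE ?station_number_lt //.
by rewrite !nth_enum_rank.
Qed.

Lemma input_inc i v : i < m ->
  arr input a_inc (i * n + station_number v) = (v \in nth set0 (enum Z) i).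
Proof.
move=> im; rewrite /input /= /n cardE (nth_allpairs _ set0 v) -?cardE ?station_number_lt //.
by rewrite nth_enum_rank.
Qed.

Lemma link_code u v : linkZ (code u) (code v) = resolved_adj u v.
Proof.
rewrite /linkZ /link code_lt !code_div !code_mod input_adj.
have -> : (code v < n) || (arr input a_inc (code v - n) != 0).
  case: v => [y|d]; first by rewrite /code mul0n station_number_lt.
  have dm := zone_number_le (inr d); rewrite /code [zone_number _]/= mulSn -addnA addKn.
  by rewrite input_inc // nth_index ?zone_mem //;
     have := valP d; rewrite inE => /andP[_ ->]; rewrite orbT.
rewrite (inj_eq station_number_inj) eqb0 negbK.
by case: u v => [x|c] [y|d] //=; rewrite ?andbF ?orbF ?andbT // eq_sym.
Qed.

Lemma switch_code u v :
  resolved_adj u v -> switch n (code u) (code v) = resolved_weight u v.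
Proof.
rewrite /switch !code_div; case: u v => [x|c] [y|d] //= _.
rewrite /zone_change eqSS; congr (nat_of_bool (~~ _)).
apply/eqP/eqP=> [/(congr1 (nth set0 (enum Z))) | -> //].
by rewrite !nth_index ?zone_mem.
Qed.

(** Codes of nodes link to codes of nodes only, so that a shortest walk among
    numbers comes from a walk in the graph. *)
Lemma link_decode q q' : linkZ q q' -> exists u, q' = code u.
Proof.
case/and3P=> q'M ok _; have n_gt0 := stations_gt0.
have rn : q' %% n < #|N| by rewrite ltn_mod.
pose v : N := enum_val (Ordinal rn).
have vE : station_number v = q' %% n by rewrite /station_number enum_valK.
have [q'n | nq'] := ltnP q' n.
  by exists (inl v); rewrite /code mul0n /= vE modn_small.
have z_gt0 : 0 < q' %/ n by rewrite divn_gt0.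
have zm : (q' %/ n).-1 < m.
  by rewrite -ltnS prednK // ltnS -ltnS ltn_divLR // mulnC.
set A := nth set0 (enum Z) (q' %/ n).-1.
have AZ : A \in Z by rewrite -mem_enum mem_nth // -cardE.
have q'E : q' - n = (q' %/ n).-1 * n + station_number v.
  by rewrite vE {1}(divn_eq q' n) -{1}(prednK z_gt0) mulSn -addnA addKn.
have Av : A \in zones Z v.
  move: ok; rewrite ltnNge nq' q'E input_inc // orFb eqb0 negbK => vA.
  by rewrite inE AZ.
exists (inr (exist (fun c : N * {set N} => c.2 \in zones Z c.1) (v, A) Av)).
rewrite /code /= index_uniq ?enum_uniq -?cardE // prednK // vE.
exact: divn_eq.
Qed.

Lemma path_code u s :
  path (@resolved_adj N Z) u s -> path linkZ (code u) (map code s).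
Proof.
by elim: s u => //= v s IH u /andP[uv /IH->]; rewrite link_code uv.
Qed.

Lemma path_decode u s : path linkZ (code u) s ->
  exists2 t, s = map code t & path (@resolved_adj N Z) u t.
Proof.
elim: s u => [|q s IH] u /=; first by exists [::].
case/andP=> uq; have [v Ev] := link_decode uq; rewrite Ev in uq *.
by case/IH=> t -> vt; exists (v :: t); rewrite //= -link_code uq.
Qed.

Lemma walk_weight_code u s : path (@resolved_adj N Z) u s ->
  walk_weight (switch n) (map code (u :: s)) =
  walk_weight (@resolved_weight N Z) (u :: s).
Proof.
elim: s u => // v s IH u /andP[uv vs].
by rewrite [map _ _]/= !walk_weight_cons2 switch_code // -(IH v vs).
Qed.

Lemma walk_between_code u v W :
  walk_between (@resolved_adj N Z) u v W ->
  walk_between linkZ (code u) (code v) (map code W).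
Proof.
by case: W => //= w s /and3P[/eqP-> /path_code-> /eqP<-]; rewrite last_map !eqxx.
Qed.

Lemma shortest_walk_decode u v V :
  shortest_walk linkZ (switch n) (code u) (code v) V ->
  exists2 W, V = map code W &
    shortest_walk (@resolved_adj N Z) (@resolved_weight N Z) u v W.
Proof.
case; case: V => // q s /and3P[/eqP-> /path_decode[t -> ut]].
rewrite last_map (inj_eq code_inj) => /eqP tv Vmin.
exists (u :: t) => //; split=> [|W' W'uv]; first by rewrite /= eqxx ut tv eqxx.
have := Vmin _ (walk_between_code W'uv).
rewrite -[code u :: _]/(map code (u :: t)) walk_weight_code //.
by case: W' W'uv => // w s' /and3P[_ ws' _]; rewrite walk_weight_code.
Qed.

End Coding.

(** * The algorithm *)

Definition prog_search := prog_tables ;; prog_budget ;; prog_trace.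

Definition algorithm := Seq (compile prog_nodes) (compile prog_search).

(** The loops of [prog_nodes] are bounded by the number of zones, and those of
    [prog_search] by [n * (m + 1) <= (n + m) * (n + m + 1)]. *)
Definition running_time : {poly nat} :=
  (cost prog_nodes + (cost prog_search \Po ('X * ('X + 1))))%R.

Lemma resolved_connected (N : ptn) (Z : {set {set N}}) x y :
  zone_cover Z -> exists W, walk_between (@resolved_adj N Z) (inl x) (inl y) W.
Proof.
move=> covZ; have /connectP[s xs ys] := adj_connected x y.
have [h Wh] := assigned_exists (x :: s) covZ.
have xsy : walk_between (@adj N) x y (x :: s) by rewrite /= xs ys !eqxx.
by have [W Wxy _] := resolved_lift xsy Wh; exists W.
Qed.

Lemma sem_algorithm (N : ptn) (Z : {set {set N}}) x y :
  zone_cover Z ->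
  exists2 W, algorithm_result Z x y W
    & outputs (sem prog_search (sem prog_nodes (encode_input Z x y))) W.
Proof.
move=> covZ; set s0 := encode_input Z x y; set s1 := sem prog_nodes s0.
set n := #|N|; set M := n * #|Z|.+1.
pose lk := link n M (arr s0 a_adj) (arr s0 a_inc).
have n_gt0 : 0 < n by exact: stations_gt0 x.
have codeE v : code (inl v : resolved_node Z) = enum_rank v by rewrite /code mul0n.
have xM : enum_rank x < M by rewrite -codeE code_lt.
have yM : enum_rank y < M by rewrite -codeE code_lt.
have [W EW Wmin] : exists2 W,
    trace M lk (switch n) (enum_rank y) M (enum_rank x) = map (@code N Z) W
    & shortest_walk (@resolved_adj N Z) (@resolved_weight N Z) (inl x) (inl y) W.
  apply: (@shortest_walk_decode N Z x y); rewrite !codeE; apply: shortest_trace => //.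
  - by move=> q q'; exact: link_lt.
  - by move=> q q'; exact: switch_le1.
  have [W /(walk_between_code x y)] := resolved_connected x y covZ.
  by rewrite !codeE; exists (map (@code N Z) W).
exists (del_repeats [seq node_station u | u <- W]); first by exists W.
have rs1 : ready n M (arr s0 a_adj) (arr s0 a_inc) (sem prog_tables s1).
  apply: sem_tables => //; [exact: sem_reg | exact: sem_nodes | exact: sem_arr..].
set s2 := sem prog_tables s1 in rs1.
have [s2x s2y] : reg s2 r_source = enum_rank x /\ reg s2 r_target = enum_rank y.
  by rewrite /s2 /s1 !(@sem_reg prog_tables) // !(@sem_reg prog_nodes).
have s2b i : arr s2 a_budget i = 0.
  by rewrite /s2 /s1 (@sem_arr prog_tables) // (@sem_arr prog_nodes) //= nth_nil.
have [s3l s3b] := sem_budget rs1 s2y yM s2b.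
set s3 := sem prog_budget s2 in s3l s3b.
have rs3 : ready n M (arr s0 a_adj) (arr s0 a_inc) s3.
  apply: ready_frame rs1 _ _ => [r | a].
    by rewrite !inE => /orP[] /eqP->; rewrite /s3 sem_reg.
  by rewrite !inE; do ?case/orP; move/eqP=> ->; rewrite /s3 sem_arr.
have s3x : reg s3 r_source = enum_rank x by rewrite /s3 (@sem_reg prog_budget).
have := sem_trace rs3 s3x xM s3l s3b.
rewrite /outputs /prog_search !sem_seq -/s2 -/s3 => ->.
rewrite EW -(del_repeats_map _ (@station_number_inj N)) -!map_comp.
by congr del_repeats; apply: eq_map => u; rewrite /= code_mod.
Qed.

Lemma algorithm_computes (N : ptn) (Z : {set {set N}}) x y :
  zone_cover Z ->
  exists2 W, algorithm_result Z x y W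
    & computes_within Z algorithm x y W running_time.[(#|N| + #|Z|)%N]%R.
Proof.
move=> covZ; have [W Wres Wout] := sem_algorithm x y covZ; exists W => //.
set s0 := encode_input Z x y in Wout *; set k := #|N| + #|Z|.
have [|t1 le1 ex1] := @exec_compile [:: r_zones] prog_nodes s0 k isT.
  by move=> r; rewrite inE => /eqP->; exact: leq_addl.
have [|t2 le2 ex2] :=
    @exec_compile [:: r_nodes] prog_search (sem prog_nodes s0) (k * (k + 1)) isT.
  move=> r; rewrite inE => /eqP->; rewrite (sem_nodes (erefl _) (erefl _)) /=.
  by rewrite leq_mul ?leq_addr // addn1 ltnS leq_addl.
exists (t1 + t2), (sem prog_search (sem prog_nodes s0)); split=> //.
  exact: ExecSeq ex1 ex2.
have -> : running_time.[k]%R =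
    (cost prog_nodes).[k]%R + (cost prog_search).[(k * (k + 1))%N]%R.
  rewrite /running_time (hornerD (cost prog_nodes)) horner_comp hornerM.
  by rewrite (hornerD 'X%R) hornerX hornerC.
exact: leq_add le1 le2.
Qed.

Theorem corollary38 :
  exists (c : cmd) (q : {poly nat}),
    forall (N : ptn) (Z : {set {set N}}) (R : realType)
           (P : nat -> R) (p : seq N -> R),
      zone_cover Z ->
      price_function P ->
      increasing_price P ->
      fare_structure p ->
      is_ZOA Z P p ->
      forall x y : N,
        (exists2 W : seq N,
            algorithm_result Z x y W &
            computes_within Z c x y W q.[(#|N| + #|Z|)%N]%R)
        /\ (forall W : seq N, algorithm_result Z x y W ->
             cheapest_path p x y W /\
             cheapest_standard_ticket p x y (standard_ticket W))
        /\ (subadditive_price P ->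
            forall W : seq N, algorithm_result Z x y W ->
              cheapest_ticket p x y (standard_ticket W)).
Proof.
exists algorithm, running_time => N Z R P p covZ _ P_incr _ pP x y.
have cheapest W (resW : algorithm_result Z x y W) : cheapest_path p x y W :=
  algorithm_result_cheapest covZ P_incr pP resW.
split; first exact: algorithm_computes.
split=> [W /cheapest W_min | P_sub W /cheapest].
  by split=> //; exact: cheapest_path_standard_ticket.
exact: (cheapest_path_ticket covZ P_incr P_sub pP).
Qed.
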